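(* Let $\mathbb{F}_q$ be a finite field, let $R=(r_1,\dots,r_m)\in\mathbb{Z}_+^m$ with $r=\sum_{i=1}^m r_i$ and $m<r\le n$. For each $j$ with $n-r+m\le j\le n$ let $p_j(s)\in\mathbb{F}_q[s]$ be a primitive polynomial of degree $j$ with companion matrix $A_j$. Let $c_2$ be the position of the active coordinate of $\Phi(R)$. Then the set of matrices that can be obtained as outputs of the matrix-extension algorithm (described in the context), over all choices made in the algorithm, is precisely the set of matrices $M\in\mathbb{F}_q^{m\times n}$ whose $c_2$-th row is $(0,\dots,0,1)$ and which occur as matrix states of multisequences in $\mathbb{F}_q^m$ with minimal polynomial $p_n(s)$ whose $R$-extensions have dimension $r$.
   Context: A multisequence in $\mathbb{F}_q^m$ is a map $W:\mathbb{Z}\to\mathbb{F}_q^m$, with values regarded as column vectors; its component sequences $W_1,\dots,W_m:\mathbb{Z}\to\mathbb{F}_q$ are its coordinates. All multisequences considered are periodic. A monic polynomial $s^n-a_{n-1}s^{n-1}-\cdots-a_0$ is associated with the linear recurring relation $W(k+n)=a_{n-1}W(k+n-1)+\cdots+a_0W(k)$ for all $k\in\mathbb{Z}$. The polynomials associated with relations satisfied by $W$ generate an ideal of $\mathbb{F}_q[s]$, whose monic generator is the minimal polynomial of $W$; its degree $n$ is the linear complexity. The matrix states of $W$ are the $m\times n$ matrices $M_W(k)=[W(k),W(k+1),\dots,W(k+n-1)]$, $k\in\mathbb{Z}$; the dimension of $W$ is the common rank of its matrix states. The shift is $(\sigma S)(k)=S(k+1)$. For $R=(r_1,\dots,r_m)\in\mathbb{Z}_+^m$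 ($\mathbb{Z}_+$ = positive integers) with $\sum r_i=r$, the $R$-extension $W_R$ of $W$ is the multisequence in $\mathbb{F}_q^r$ whose component sequences are, in order, $W_1,\sigma W_1,\dots,\sigma^{r_1-1}W_1,\dots,W_m,\sigma W_m,\dots,\sigma^{r_m-1}W_m$. The companion matrix of $s^j-a_{j-1}s^{j-1}-\cdots-a_0$ is the $j\times j$ matrix with $1$'s on the subdiagonal, last column $(a_0,\dots,a_{j-1})^T$ and zeros elsewhere, so that the row vectors $x(k)=[S(k),\dots,S(k+j-1)]$ of a sequence $S$ satisfying the recurrence obey $x(k+1)=x(k)A_j$. A primitive polynomial of degree $j$ over $\mathbb{F}_q$ is the minimal polynomial of a generator of $\mathbb{F}_{q^j}^*$. For $G=(g_1,\dots,g_m)\in\mathbb{Z}_+^m$ let $G_{max}=\max_i g_i$; for $G\ne\mathbf{1}=(1,\dots,1)$ let $\Phi(G)$ be obtained from $G$ by decreasing $g_c$ by $1$, where $c$ is the smallest index with $g_c=G_{max}$. The $R$-road is the path $R,\Phi(R),\Phi^2(R),\dots,\mathbf{1}$. For a point $G\neq R$ on the $R$-road, the active coordinate of $G$ has position $c$ defined as follows: if there is an index $c$ with $g_c=G_{max}-1$ and $g_c<r_c$, take the largest such $c$; otherwise take the largest $c$ with $g_c=G_{max}$ and $g_c<r_c$. Matrix-extension algorithm. Let $e_j^j=(0,\dots,0,1)\in\mathbb{F}_q^j$. Initialize $G=\mathbf{1}$, $g=m$, and $M$ to any matrix in $\mathbb{F}_q^{m\times(n-r+m)}$ of full row rank. While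 $g<r$, do the following: let $c$ be the position of the active coordinate of $G$; find a polynomial $f(s)\in\mathbb{F}_q[s]$ such that (the $c$-th row of $M$) times $f(A_{n-r+g})$ equals $e_{n-r+g}^{n-r+g}$; replace $M$ by $Mf(A_{n-r+g})$; for every $i\ne c$ append to the $i$-th row of $M$ an arbitrary element $d_i\in\mathbb{F}_q$, and replace the $c$-th row by $e_{n-r+g+1}^{n-r+g+1}$; increase $g$ and $g_c$ by $1$. The output is the final $M\in\mathbb{F}_q^{m\times n}$. *)

(* Defs.v *)
From HB Require Import structures.
From mathcomp Require Import all_boot all_order all_algebra all_field.
Set Implicit Arguments.
Unset Strict Implicit.
Unset Printing Implicit Defensive.
Import Order.TTheory GRing.Theory Num.Theory.
Local Open Scope ring_scope.

Section Multisequences.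
Variables (F : fieldType) (m : nat).
Implicit Types (W : int -> 'cV[F]_m) (p q : {poly F}).

Definition periodic W := exists2 T : nat, (0 < T)%N & forall k, W (k + T%:Z) = W k.

(* For p = s^d - a_(d-1) s^(d-1) - ... - a_0 we have a_i = - p`_i. *)
Definition satisfies W p :=
  p \is monic /\
  forall k : int,
    W (k + ((size p).-1)%:Z) =
      \sum_(i < (size p).-1) (- p`_i) *: W (k + (i : nat)%:Z).

Definition in_ideal_gen (S : {poly F} -> Prop) (f : {poly F}) :=
  exists2 u : seq ({poly F} * {poly F}),
    forall x, x \in u -> S x.2 & f = \sum_(x <- u) x.1 * x.2.

(* q is the monic generator of the ideal of the relations satisfied by W. *)
Definition is_minimal_polynomial W q :=
  q \is monic /\ forall f, in_ideal_gen (satisfies W) f <-> q %| f.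

Definition is_linear_complexity W (n : nat) :=
  exists2 q, is_minimal_polynomial W q & n = (size q).-1.

Definition matrix_state W (n : nat) (k : int) : 'M[F]_(m, n) :=
  \matrix_(i < m, j < n) W (k + (j : nat)%:Z) i 0.

Definition is_matrix_state_of W (n : nat) (M : 'M[F]_(m, n)) :=
  is_linear_complexity W n /\ exists k : int, M = matrix_state W n k.

Definition has_dimension W (d : nat) :=
  exists2 n, is_linear_complexity W n &
    forall k : int, \rank (matrix_state W n k) = d.

Definition component W (i : 'I_m) : int -> F := fun k => W k i 0.

Definition shift (T : Type) (S : int -> T) : int -> T := fun k => S (k + 1).

Definition extension (R : {ffun 'I_m -> nat}) W :
    int -> 'cV[F]_(\sum_(i < m) R i) :=
  fun k => \mxcol_(i < m)
    \col_(j < R i) iter j (@shift F) (component W i) k.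

End Multisequences.

Section Polynomials.
Variable F : finFieldType.

(* Transposed with respect to the library's companionmx. *)
Definition companion (j : nat) (p : {poly F}) : 'M[F]_j :=
  \matrix_(i < j, k < j)
    if k.+1 == j then - p`_i else ((i : nat) == k.+1)%:R.

(* L is the field with #|F|^j elements; L^* being finite, natural exponents
   suffice to say that z generates it. *)
Definition primitive_polynomial (j : nat) (p : {poly F}) :=
  exists (L : fieldExtType F) (z : L),
    [/\ \dim {:L} = j,
        z != 0,
        forall y : L, y != 0 -> exists k : nat, y = z ^+ k
      & map_poly (in_alg L) p = minPoly 1%VS z].

End Polynomials.

Section Road.
Variable m : nat.
Implicit Types (R G : {ffun 'I_m -> nat}).

Definition gmax G : nat := \max_(i < m) G i.

Definition first_max G (c : 'I_m) : bool :=
  (G c == gmax G) && [forall i : 'I_m, (i < c)%N ==> (G i != gmax G)].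

(* Only meaningful when all G i are positive and G is not constantly 1. *)
Definition Phi G : {ffun 'I_m -> nat} :=
  [ffun i => if first_max G i then (G i).-1 else G i].

Definition largest_such (P : pred 'I_m) (c : 'I_m) : bool :=
  P c && [forall i : 'I_m, P i ==> (i <= c)%N].

(* c is the position of the active coordinate of G on the R-road. *)
Definition active R G (c : 'I_m) : bool :=
  let below i := (G i == (gmax G).-1) && (G i < R i)%N in
  let top i := (G i == gmax G) && (G i < R i)%N in
  if [exists i : 'I_m, below i] then largest_such below c
  else largest_such top c.

End Road.

Definition last_unit (F : finFieldType) (j : nat) : 'rV[F]_j :=
  \row_(k < j) (k.+1 == j)%:R.

Section Algorithm.
Variables (F : finFieldType) (m n r : nat) (R : {ffun 'I_m -> nat}).
Variable p : nat -> {poly F}.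

(* Appends the entry d i to each row i <> c of N and replaces row c by
   (0, ..., 0, 1). *)
Definition enlarge (j : nat) (c : 'I_m) (d : 'I_m -> F) (N : 'M[F]_(m, j)) :
    'M[F]_(m, j.+1) :=
  \matrix_(i < m, k < j.+1)
    if i == c then last_unit F j.+1 0 k
    else if unlift ord_max k is Some k' then N i k' else d i.

(* alg_state G g M: the variables of the algorithm can have the values G, g, M
   on entry to the while test.  The width of M is always n - r + g; it is
   positive (since m > 0), hence the source width j.+1 required by horner_mx. *)
Inductive alg_state :
    {ffun 'I_m -> nat} -> nat -> forall j : nat, 'M[F]_(m, j) -> Prop :=
| AlgInit (M : 'M[F]_(m, n - r + m)) :
    row_free M -> alg_state [ffun=> 1%N] m M
| AlgStep (G : {ffun 'I_m -> nat}) (g j : nat) (M : 'M[F]_(m, j.+1))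
    (c : 'I_m) (f : {poly F}) (d : 'I_m -> F) :
    alg_state G g M ->
    (g < r)%N ->
    active R G c ->
    row c M *m horner_mx (companion j.+1 (p j.+1)) f = last_unit F j.+1 ->
    alg_state [ffun i => if i == c then (G i).+1 else G i] g.+1
      (enlarge c d (M *m horner_mx (companion j.+1 (p j.+1)) f)).

Definition alg_output (M : 'M[F]_(m, n)) :=
  exists (G : {ffun 'I_m -> nat}) (g : nat), alg_state G g M /\ ~~ (g < r)%N.

End Algorithm.

(* Main.v *)
(** Write A for the companion matrix at width w and let a polynomial u act on row
vectors by x |-> x u(A).  The R-extension of W has dimension r iff the vectors
x_i A^k (x_i the i-th row of a state, k < r_i) are linearly independent.

Suppose row c of a width-w matrix is the last unit vector e and G has
coordinates at most g_c + 1.  Since e, eA, ..., eA^(g_c - 1) span the vectors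
supported on the last g_c coordinates, the independence of the G-extension only
concerns the first w - g_c coordinates of the other vectors x_i A^k, and these
are plain shifts of x_i, in which the polynomial does not intervene.  Appending
arbitrary entries to these rows and replacing w, g_c by w + 1, g_c + 1 leaves
that condition unchanged, so one enlargement step of the algorithm preserves and
reflects independence.  The multiplication by f(A) is invertible because the
polynomial is irreducible, and the R-road visits only points where g_c is within
1 of the maximum; hence the algorithm can also be run backwards from any
admissible matrix. *)

Require Import Defs.
From HB Require Import structures.
From mathcomp Require Import all_boot all_order all_fingroup all_algebra all_field.
From mathcomp Require Import zify.
Set Implicit Arguments.
Unset Strict Implicit.
Unset Printing Implicit Defensive.
Import Order.TTheory GRing.Theory Num.Theory.
Local Open Scope ring_scope.

(** * The R-road *)

Section RoadTheory.
Variables (m : nat) (R : {ffun 'I_m -> nat}).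
Implicit Types (G : {ffun 'I_m -> nat}) (c : 'I_m).
Local Open Scope nat_scope.

Lemma first_max_uniq G c c' : first_max G c -> first_max G c' -> c = c'.
Proof.
move=> /andP[/eqP Ec /forallP Hc] /andP[/eqP Ec' /forallP Hc'].
apply: val_inj => /=.
move: (Hc c') (Hc' c); rewrite Ec Ec' eqxx !implybF -!leqNgt => h1 h2.
by apply/eqP; rewrite eqn_leq h1 h2.
Qed.

Lemma largest_such_uniq (P : pred 'I_m) c c' :
  largest_such P c -> largest_such P c' -> c = c'.
Proof.
move=> /andP[Pc /forallP Hc] /andP[Pc' /forallP Hc'].
apply: val_inj; apply/eqP; rewrite eqn_leq.
by move: (Hc c') (Hc' c); rewrite Pc Pc' /= => -> ->.
Qed.

Lemma active_uniq G c c' : active R G c -> active R G c' -> c = c'.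
Proof. by rewrite /active; case: ifP => _; apply: largest_such_uniq. Qed.

Lemma gmax_eq G c (h : nat) : G c = h -> (forall i, G i <= h) -> gmax G = h.
Proof.
move=> Gc leG; apply/eqP; rewrite eqn_leq; apply/andP; split.
  by apply/bigop.bigmax_leqP => i _; apply: leG.
by rewrite -[X in X <= _]Gc; apply: bigop.leq_bigmax.
Qed.

Lemma leq_gmax G i : G i <= gmax G.
Proof. exact: bigop.leq_bigmax. Qed.

Lemma gmax_witness G : 0 < m -> exists c, G c = gmax G.
Proof.
move=> m_gt0; have [|c Ec] := @bigop.eq_bigmax _ (fun i => G i).
  by rewrite card_ord.
by exists c; rewrite /gmax Ec.
Qed.

Lemma first_max_ex G : 0 < m -> exists c, first_max G c.
Proof.
move=> /gmax_witness -/(_ G) [c0 Ec0].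
case: (@arg_minnP _ c0 (fun i => G i == gmax G) (@nat_of_ord m)); first exact/eqP.
move=> c Ec Hc; exists c; rewrite /first_max Ec; apply/forallP => i.
by apply/implyP; apply: contraL => /Hc; rewrite -leqNgt.
Qed.

Lemma Phi_first_max G c :
  first_max G c -> Phi G = [ffun i => if i == c then (G i).-1 else G i].
Proof.
move=> Hc; apply/ffunP => i; rewrite !ffunE.
case: eqP => [->|ne]; first by rewrite Hc.
by case: ifP => // /(first_max_uniq Hc) /esym.
Qed.

Lemma raise_Phi G c : first_max G c -> 0 < G c ->
  [ffun i => if i == c then (Phi G i).+1 else Phi G i] = G.
Proof.
move=> Hc G_gt0; rewrite (Phi_first_max Hc); apply/ffunP => i; rewrite !ffunE.
by case: eqP => // ->; rewrite prednK.
Qed.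

(* The points of the R-road at height h: min(R, h) with the coordinates at
   height h and position below t lowered by 1. *)
Definition on_road G := exists h t : nat,
  [/\ 0 < h, gmax G = h &
      forall i, G i = minn (R i) (if i < t then h.-1 else h)].

Lemma on_road_start : (forall i, 0 < R i) -> 0 < m -> on_road R.
Proof.
move=> R_gt0 /gmax_witness -/(_ R) [c Ec]; exists (gmax R), 0; split=> //.
  by rewrite -Ec.
by move=> i; rewrite ltn0; apply/esym/minn_idPl/leq_gmax.
Qed.

(** Coordinates from [t] up to [c] that miss the maximum [h] are capped by [R], so lowering [c] only
    moves the threshold from [t] to [c.+1]. *)
Lemma on_road_Phi G c : on_road G -> 1 < gmax G -> first_max G c ->
  on_road (Phi G) /\ active R (Phi G) c.
Proof.
move=> [h [t [h_gt0 Gh EG]]] h_gt1 Hc; have /andP[/eqP Ec /forallP minc] := Hc.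
rewrite Gh in h_gt1 Ec.
have Rc : h <= R c by move: (EG c); lia.
have tc : t <= c by move: (EG c); case: ifP; lia.
have low (i : 'I_m) : i < c -> t <= i -> R i < h.
  move=> ic ti; move: (minc i) (EG i); rewrite ic Gh /= => /eqP.
  by case: ifP; lia.
have EP i : Phi G i = minn (R i) (if i < c.+1 then h.-1 else h).
  rewrite (Phi_first_max Hc) ffunE; case: eqP => [->|/eqP ne].
    by rewrite ltnSn Ec; lia.
  rewrite EG; have : (i : nat) <> c by move=> /val_inj e; rewrite e eqxx in ne.
  case: (ltnP i t) => it; case: (ltnP i c.+1) => ic; try lia.
  by have := low i; lia.
have EPc : Phi G c = h.-1 by rewrite EP ltnSn; lia.
(* If a later coordinate still stands at [h], the maximum stays [h] and [c] is the last coordinate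
   at [h.-1] with room under [R]. Otherwise the maximum drops to [h.-1], the threshold restarts at
   0, and [c] is the last top coordinate with room. *)
case: (pickP (fun i : 'I_m => (c < i) && (h <= R i))) => [i /andP[ci Ri]|none].
  have Pmax : gmax (Phi G) = h.
    apply: (@gmax_eq _ i); first by rewrite EP ltnS leqNgt ci /=; lia.
    by move=> k; rewrite EP; case: ifP; lia.
  split; first by exists h, c.+1.
  have belowc : (Phi G c == (gmax (Phi G)).-1) && (Phi G c < R c).
    by rewrite Pmax EPc; lia.
  rewrite /active; case: existsP => [_|[]]; last by exists c.
  rewrite /largest_such belowc; apply/forallP => k; apply/implyP.
  by rewrite Pmax EP; case: ifP; lia.
have Pmax : gmax (Phi G) = h.-1.
  apply: (@gmax_eq _ c) => // k; move: (none k); rewrite EP.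
  by case: ifP; lia.
split.
  exists h.-1, 0; split; [lia | exact: Pmax |] => k.
  by move: (none k); rewrite EP ltn0; case: ifP; lia.
rewrite /active; case: existsP => [[k]|_].
  by move: (none k); rewrite Pmax EP; case: ifP; lia.
rewrite /largest_such Pmax EPc; apply/andP; split; first lia.
apply/forallP => k; apply/implyP; move: (none k).
by rewrite EP; case: ifP; lia.
Qed.

Lemma sum_raise G c :
  \sum_(i < m) [ffun i => if i == c then (G i).+1 else G i] i
    = (\sum_(i < m) G i).+1.
Proof.
rewrite (bigD1 c) //= [in RHS](bigD1 c) //= ffunE eqxx addSn.
by congr (_ + _).+1; apply: eq_bigr => i /negbTE ne; rewrite ffunE ne.
Qed.

Lemma gmax_gt1 G : m < \sum_(i < m) G i -> 1 < gmax G.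
Proof.
apply: contraLR; rewrite -!leqNgt => le1.
rewrite -[X in _ <= X](card_ord m) -sum1_card; apply: leq_sum => i _.
exact: leq_trans (leq_gmax _ _) le1.
Qed.

Lemma sum_eq1 G : (forall i, 0 < G i) -> \sum_(i < m) G i = m ->
  G = [ffun=> 1].
Proof.
move=> G_gt0 sumG; apply/ffunP => i; rewrite ffunE.
have /leqif_sum := fun (j : 'I_m) (_ : true) => leqif_eq (G_gt0 j).
rewrite sum1_card card_ord sumG => /leqifP.
by case: ifP => [/forallP /(_ i) /= /eqP //|]; rewrite ltnn.
Qed.

Lemma iter_Phi_road t : (forall i, 0 < R i) -> 0 < m ->
  m + t <= \sum_(i < m) R i ->
  let G := iter t (@Phi m) R in
  [/\ on_road G, forall i, 0 < G i & \sum_(i < m) G i + t = \sum_(i < m) R i].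
Proof.
move=> R_gt0 m_gt0; elim: t => [_|t IH le] /=.
  by rewrite addn0; split=> //; apply: on_road_start.
have [|rG G_gt0 sumG] := IH; first lia.
set G := iter t (@Phi m) R in rG G_gt0 sumG *.
have G1 : 1 < gmax G by apply: gmax_gt1; lia.
have [c Hc] := first_max_ex G m_gt0.
have [rP _] := on_road_Phi rG G1 Hc.
have sumP : \sum_(i < m) G i = (\sum_(i < m) Phi G i).+1.
  by rewrite -(raise_Phi Hc (G_gt0 c)) sum_raise raise_Phi.
split=> //; last by rewrite addnS -addSn -sumP.
move=> i; rewrite (Phi_first_max Hc) ffunE; case: eqP => // ->.
by case/andP: Hc => /eqP ->; lia.
Qed.

End RoadTheory.

(** * Companion matrices of irreducible polynomials *)

(** Every nonzero element of [L] is a power of [z], so [z] generates [L] over [F] and its minimal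
    polynomial has degree [\dim {:L}]. *)
Lemma primitive_irreducible (F : finFieldType) (j : nat) (p : {poly F}) :
  primitive_polynomial j p ->
  [/\ p \is monic, size p = j.+1 & irreducible_poly p].
Proof.
move=> [L [z [dimL z_neq0 zgen Ep]]].
have full : <<1; z>>%VS = fullv.
  apply/eqP; rewrite eqEsubv subvf; apply/subvP => y _.
  have [->|/zgen [k ->]] := eqVneq y 0; first exact: mem0v.
  by rewrite rpredX // memv_adjoin.
have sz : size p = j.+1.
  rewrite -(size_map_poly (in_alg L)) Ep size_minPoly -dimL -full.
  by rewrite dim_Fadjoin dimv1 muln1.
have j_gt0 : (0 < j)%N by rewrite -dimL adim_gt0.
split=> //; first by rewrite -(map_monic (in_alg L)) Ep monic_minPoly.
split=> [|q q_neq1 q_dvd]; first by rewrite sz ltnS.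
have q_over : map_poly (in_alg L) q \is a polyOver 1%VS.
  by apply/polyOver1P; exists q.
have := @minPoly_irr _ _ 1%AS z _ q_over; rewrite -Ep dvdp_map q_dvd => /(_ isT).
rewrite eqp_map => /orP[] //; rewrite -(rmorph1 (map_poly (in_alg L))) eqp_map.
by move=> /eqp_size; rewrite size_poly1 => /eqP; rewrite (negbTE q_neq1).
Qed.

Section Companion.
Variables (F : finFieldType) (w : nat) (p : {poly F}).
Let A := companion w.+1 p.
Implicit Types (x y : 'rV[F]_w.+1) (u v f : {poly F}).

Lemma mul_companion x (b : nat) : (b < w)%N ->
  (x *m A) 0 (inord b) = x 0 (inord b.+1).
Proof.
move=> bw; rewrite mxE (bigD1 (inord b.+1)) //= mxE !inordK //; last exact: ltnW.
rewrite eqSS ltn_eqF // eqxx mulr1 big1 ?addr0 // => i ne.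
rewrite mxE inordK ?ltnS 1?ltnW // ltn_eqF // [_ == b.+1]negbTE ?mulr0 //.
by apply: contra ne => /eqP <-; rewrite inord_val.
Qed.

Lemma mul_companionX x (a b : nat) : (a + b <= w)%N ->
  (x *m A ^+ a) 0 (inord b) = x 0 (inord (a + b)).
Proof.
elim: a b => [|a IH] b ab; first by rewrite expr0 mulmx1.
rewrite exprSr mulmxA mul_companion; last by lia.
by rewrite IH addnS // -addSn.
Qed.

Lemma mul_horner x u : x *m horner_mx A u = \sum_(a < size u) u`_a *: (x *m A ^+ a).
Proof.
rewrite -{1}[u]coefK poly_def rmorph_sum mulmx_sumr; apply: eq_bigr => a _ /=.
by rewrite linearZ rmorphXn /= horner_mx_X -scalemxAr.
Qed.

Lemma mul_horner_wide x u N : (size u <= N)%N ->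
  x *m horner_mx A u = \sum_(a < N) u`_a *: (x *m A ^+ a).
Proof.
move=> le; rewrite mul_horner (big_ord_widen N (fun a => u`_a *: (x *m A ^+ a))) //.
rewrite big_mkcond; apply: eq_bigr => a _; case: ltnP => // /(nth_default 0) ->.
by rewrite scale0r.
Qed.

(** In this range powers of [A] act as plain left shifts. *)
Lemma mul_horner_coord x u (b : nat) : (size u + b <= w.+1)%N ->
  (x *m horner_mx A u) 0 (inord b) = \sum_(a < size u) u`_a * x 0 (inord (a + b)).
Proof.
move=> le; rewrite mul_horner summxE; apply: eq_bigr => a _.
by rewrite mxE mul_companionX //; have := ltn_ord a; lia.
Qed.

Lemma last_unitE b : (b <= w)%N -> last_unit F w.+1 0 (inord b) = (b == w)%:R.
Proof. by move=> ?; rewrite mxE inordK. Qed.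

Lemma last_unit_horner_low u g b : (size u <= g)%N -> (b + g <= w)%N ->
  (last_unit F w.+1 *m horner_mx A u) 0 (inord b) = 0.
Proof.
move=> su bg; rewrite mul_horner_coord; last by lia.
apply: big1 => a _; have := ltn_ord a => ?.
by rewrite last_unitE ?ltn_eqF ?mulr0 //; lia.
Qed.

(** The leading coefficient of [u] is the entry of the product at position [w.+1 - size u]. *)
Lemma last_unit_horner_inj u : (size u <= w.+1)%N ->
  last_unit F w.+1 *m horner_mx A u = 0 -> u = 0.
Proof.
move=> su e0; apply/eqP; apply: contraT; rewrite -lead_coef_eq0 => /eqP [].
have [su0|su0] := posnP (size u).
  by rewrite lead_coefE nth_default // su0.
have /rowP/(_ (inord (w.+1 - size u))) := e0.
rewrite mul_horner_coord; last by lia.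
rewrite mxE; have lt_d : ((size u).-1 < size u)%N by rewrite prednK.
rewrite (bigD1 (Ordinal lt_d)) //= big1 ?addr0 => [|a ne].
  have Ed : ((size u).-1 + (w.+1 - size u) = w)%N by lia.
  by rewrite Ed last_unitE ?leqnn // eqxx mulr1.
have ne' : a != (size u).-1 :> nat by [].
have alt : (a < size u)%N := ltn_ord a.
have Ea : (a + (w.+1 - size u) < w)%N by lia.
by rewrite last_unitE ?(ltnW Ea) // ltn_eqF ?mulr0.
Qed.

(** The image of the last unit vector under [A ^+ g] has entry 1 at position [w - g] and zeros
    before it, so subtracting a multiple clears that position of [x]. For [g = w.+1] the condition
    on [x] is vacuous: the last unit vector is cyclic. *)
Lemma last_unit_horner_span x (g : nat) : (g <= w.+1)%N ->
  (forall b, (b + g <= w)%N -> x 0 (inord b) = 0) ->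
  exists2 u : {poly F}, (size u <= g)%N & x = last_unit F w.+1 *m horner_mx A u.
Proof.
elim: g x => [|g IH] x gw x0.
  exists 0; first by rewrite size_poly0.
  rewrite rmorph0 mulmx0; apply/rowP => b; rewrite -(inord_val b) x0 ?mxE //.
  by rewrite addn0 -ltnS.
pose a := x 0 (inord (w - g)).
have [|b bg|u su Eu] := IH (x - a *: (last_unit F w.+1 *m horner_mx A 'X^g)).
- exact: ltnW.
- rewrite [LHS]mxE [X in _ + X]mxE [X in - X]mxE mul_horner_coord ?size_polyXn; last by lia.
  rewrite big_ord_recr /= big1 ?add0r => [|i _]; last first.
    by rewrite coefXn ltn_eqF ?mul0r.
  rewrite coefXn eqxx mul1r last_unitE 1?addnC //.
  have [E|ne] := eqVneq (b + g)%N w.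
    have -> : b = (w - g)%N by lia.
    by rewrite mulr1 subrr.
  by rewrite mulr0 subr0 x0 //; lia.
exists (u + a *: 'X^g).
  rewrite (leq_trans (size_polyD _ _)) // geq_max ltnW //=.
  by rewrite (leq_trans (size_scale_leq _ _)) ?size_polyXn.
by rewrite rmorphD mulmxDr -Eu /= horner_mxZ -scalemxAr subrK.
Qed.

Hypotheses (p_monic : p \is monic) (sz_p : size p = w.+2).

Lemma companion_trmx : (companion (size p).-1 p)^T = companionmx p.
Proof.
apply/matrixP => i j; rewrite !mxE.
have -> : (i.+1 == (size p).-1) = (i == (size p).-1.-1 :> nat).
  by case: i => [i ilt] /=; move: ilt; rewrite sz_p.
by rewrite [(j : nat) == _]eq_sym.
Qed.

Lemma horner_companion : horner_mx A p = 0.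
Proof.
have := companionmxK p_monic; rewrite -companion_trmx /char_poly => E.
have {}E : char_poly (companion (size p).-1 p) = p.
  rewrite -[RHS]E /char_poly -det_tr; congr (\det _).
  by rewrite /char_poly_mx linearB /= tr_scalar_mx map_trmx.
rewrite sz_p in E.
by rewrite -[X in horner_mx _ X]E Cayley_Hamilton.
Qed.

Hypothesis p_irr : irreducible_poly p.

Lemma horner_companion_inv f : ~~ (p %| f) ->
  exists h, horner_mx A f *m horner_mx A h = 1%:M.
Proof.
rewrite -(irreducible_poly_coprime _ p_irr) => /Bezout_eq1_coprimepP[[v h] /= E].
exists h; rewrite -[_ *m _](rmorphM (horner_mx A)) [f * h]mulrC.
have -> : h * f = 1 - v * p by rewrite -E addrC addKr.
by rewrite rmorphB rmorphM rmorph1 /= horner_companion mulr0 subr0.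
Qed.

Lemma horner_companion_unit f : ~~ (p %| f) -> horner_mx A f \in unitmx.
Proof. by move=> /horner_companion_inv[h /mulmx1_unit[]]. Qed.

Lemma horner_companion_ker x f : x != 0 -> x *m horner_mx A f = 0 -> p %| f.
Proof.
move=> x0 xf0; apply: contraT => /horner_companion_unit uf.
by rewrite -(mulmxK uf x) xf0 mul0mx eqxx in x0.
Qed.

Lemma horner_companion_kerN x f : x *m horner_mx A f != 0 -> ~~ (p %| f).
Proof.
apply: contra => /dvdpP[q ->].
by rewrite rmorphM /= horner_companion mulr0 mulmx0.
Qed.

Lemma last_unit_neq0 : last_unit F w.+1 != 0.
Proof.
apply/eqP => /rowP/(_ (inord w)); rewrite last_unitE // eqxx mxE.
by move/eqP; rewrite oner_eq0.
Qed.

(** Cyclicity writes [x] as the image of the last unit vector under some [u]; as [x] is nonzero, [p]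
    does not divide [u], and [u] can be inverted modulo [p]. *)
Lemma horner_to_last_unit x : x != 0 ->
  exists h, x *m horner_mx A h = last_unit F w.+1.
Proof.
move=> x0; have [b bw|u _ Ex] := @last_unit_horner_span x w.+1 (leqnn _).
  by move: bw; lia.
have /horner_companion_inv[h Eh] : ~~ (p %| u).
  by apply: (@horner_companion_kerN (last_unit F w.+1)); rewrite -Ex.
by exists h; rewrite Ex -mulmxA Eh mulmx1.
Qed.

End Companion.

(** * Linear independence of rows and their images under powers of a matrix *)

Section Independence.
Variables (F : finFieldType) (m : nat).
Implicit Types (G : 'I_m -> nat).

(* Linear independence of the row i M *m A ^+ k, k < G i: the u i collect the
   coefficients of a relation. *)
Definition indep w G (A : 'M[F]_w.+1) (M : 'M[F]_(m, w.+1)) :=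
  forall u : 'I_m -> {poly F}, (forall i, size (u i) <= G i)%N ->
    \sum_(i < m) row i M *m horner_mx A (u i) = 0 -> forall i, u i = 0.

Lemma indep_mulr w G (A B : 'M[F]_w.+1) M :
  B \in unitmx -> comm_mx A B -> indep G A M -> indep G A (M *m B).
Proof.
move=> uB cAB iM u su e0; apply: iM => //; rewrite -[LHS](mulmxK uB).
rewrite mulmx_suml (eq_bigr (fun i => row i (M *m B) *m horner_mx A (u i))).
  by rewrite e0 mul0mx.
by move=> i _; rewrite row_mul -!mulmxA; congr (_ *m _); apply: comm_horner_mx.
Qed.

Lemma indep_row_neq0 w G (A : 'M[F]_w.+1) M i :
  indep G A M -> (0 < G i)%N -> row i M != 0.
Proof.
move=> iM Gi; apply/eqP => Mi0.
have : (1 : {poly F}) = 0; last by move/eqP; rewrite oner_eq0.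
have := iM (fun k => if k == i then 1 else 0) => /(_ _ _ i); rewrite eqxx; apply.
  by move=> k; case: eqP => [->|_]; rewrite ?size_poly1 ?size_poly0.
apply: big1 => k _; case: eqP => [->|_]; first by rewrite Mi0 mul0mx.
by rewrite rmorph0 mulmx0.
Qed.

(** Polynomials of size at most 1 are constants, hence the entries of a vector [v] with
    [v *m M = 0]. *)
Lemma indep1 w (A : 'M[F]_w.+1) M : row_free M <-> indep (fun=> 1%N) A M.
Proof.
have sumE (v : 'rV[F]_m) : v *m M = \sum_i row i M *m horner_mx A (v 0 i)%:P.
  rewrite mulmx_sum_row; apply: eq_bigr => i _.
  by rewrite horner_mx_C mul_mx_scalar.
split=> [fM u su e0 i|iM].
  have Eu k : u k = ((\row_j (u j)`_0) 0 k)%:P by rewrite mxE -size1_polyC.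
  move: e0; under eq_bigr do rewrite Eu; rewrite -sumE -(mul0mx _ M).
  by move/(row_free_inj fM)/rowP/(_ i); rewrite !mxE => e; rewrite Eu mxE e.
rewrite -kermx_eq0; apply/rowV0P => v /sub_kermxP; rewrite sumE => /iM E.
apply/rowP => i; have := E (fun k => size_polyC_leq1 _) i.
by rewrite mxE => /polyC_inj.
Qed.

End Independence.

(** * Independence when one row is the last unit vector *)

Section Step.
Variables (F : finFieldType) (m : nat) (c : 'I_m).

(* The condition left on the rows other than c once row c is the last unit
   vector, whose images under x^0, ..., x^(g-1) span the vectors supported on
   the last g coordinates. *)
Definition reduced (G : 'I_m -> nat) (g w : nat) (E : 'I_m -> nat -> F) :=
  forall u : 'I_m -> {poly F},
    (forall i, i != c -> size (u i) <= G i)%N ->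
    (forall b, (b + g <= w)%N ->
      \sum_(i < m | i != c) \sum_(a < size (u i)) (u i)`_a * E i (a + b)%N = 0) ->
    forall i, i != c -> u i = 0.

(** The bound [G i <= (G c).+1] keeps the first [w.+1 - G c] coordinates of the other images in the
    range where [A] acts as a shift. The entries are passed as a function [E] on [nat] so that
    matrices of different widths can share it. *)
Lemma indep_reduced w (p : {poly F}) (G : 'I_m -> nat) (M : 'M[F]_(m, w.+1)) E :
  row c M = last_unit F w.+1 ->
  (G c <= w.+1)%N -> (forall i, i != c -> G i <= (G c).+1)%N ->
  (forall i k, i != c -> (k + G c < w + G i)%N -> M i (inord k) = E i k) ->
  indep G (companion w.+1 p) M <-> reduced G (G c) w E.
Proof.
move=> Mc Gcw Gle ME.
set A := companion w.+1 p.
have red (u : 'I_m -> {poly F}) b : (forall i, i != c -> size (u i) <= G i)%N ->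
    (b + G c <= w)%N ->
    (\sum_(i < m | i != c) row i M *m horner_mx A (u i)) 0 (inord b) =
    \sum_(i < m | i != c) \sum_(a < size (u i)) (u i)`_a * E i (a + b)%N.
  move=> su bw; rewrite summxE; apply: eq_bigr => i ic.
  have := su i ic; have := Gle i ic => h1 h2.
  rewrite mul_horner_coord //; last by lia.
  apply: eq_bigr => a _; rewrite mxE ME //; have := ltn_ord a; lia.
split=> [iM u su u0 i ic|rM u su].
  (* By hypothesis [y] is supported on the last [G c] coordinates, so [- y] is the image of row [c]
     under some [v], which completes [u] to a full relation. *)
  pose y := \sum_(i < m | i != c) row i M *m horner_mx A (u i).
  have [b bw|v sv Ev] := @last_unit_horner_span _ _ p (- y) (G c) Gcw.
    by rewrite mxE red // u0 ?oppr0.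
  have := iM (fun k => if k == c then v else u k) => /(_ _ _ i).
  rewrite (negbTE ic); apply.
    by move=> k; case: eqP => [->|/eqP /su].
  rewrite (bigD1 c) //= eqxx Mc -Ev; apply/eqP; rewrite addrC subr_eq0; apply/eqP.
  by apply: eq_bigr => k /negbTE ->.
rewrite (bigD1 c) //= Mc => e0.
have u0 i : i != c -> u i = 0.
  apply: (rM u) => // b bw; rewrite -red //.
  have /rowP/(_ (inord b)) := e0.
  by rewrite mxE (last_unit_horner_low _ (su c)) // add0r => ->; rewrite mxE.
move=> i; have [->|/u0 //] := eqVneq i c.
apply: (@last_unit_horner_inj _ w p); first exact: leq_trans (su c) _.
move: e0; rewrite big1 ?addr0 // => k /u0 ->.
by rewrite rmorph0 mulmx0.
Qed.

(** Both sides reduce to the same condition: it sees [w] and [G c] only through their difference,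
    and [G i <= (G c).+1] confines it to columns [k <= w], before the appended one. *)
Lemma indep_raise w (p q : {poly F}) (G G' : 'I_m -> nat)
    (N : 'M[F]_(m, w.+1)) (M : 'M[F]_(m, w.+2)) :
  row c N = last_unit F w.+1 -> row c M = last_unit F w.+2 ->
  (forall i k, i != c -> (k <= w)%N -> M i (inord k) = N i (inord k)) ->
  G' c = (G c).+1 -> (forall i, i != c -> G' i = G i) ->
  (G c <= w.+1)%N -> (forall i, i != c -> G i <= (G c).+1)%N ->
  indep G (companion w.+1 p) N <-> indep G' (companion w.+2 q) M.
Proof.
move=> Nc Mc MN Gc' GG' Gcw Gle.
rewrite (@indep_reduced _ p G N (fun i k => N i (inord k))) //.
rewrite (@indep_reduced _ q G' M (fun i k => N i (inord k))) //.
- rewrite Gc'; split=> H u su u0; apply: H => // i.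
  + by move=> ic; rewrite -GG' ?su.
  + by move=> bw; apply: u0; lia.
  + by move=> ic; rewrite GG' ?su.
  + by move=> bw; apply: u0; lia.
- by rewrite Gc'.
- by move=> i ic; rewrite GG' // Gc'; have := Gle i ic; lia.
- move=> i k ic; rewrite Gc' GG' // => kw; apply: MN => //.
  by have := Gle i ic; lia.
Qed.
End Step.

(** * Multisequences and their states *)

Section Relations.
Variables (F : fieldType) (m : nat).
Implicit Types (W : int -> 'cV[F]_m) (p q : {poly F}).

(** This is [q] evaluated at the shift operator and applied to [W]; relations become the monic
    annihilators of [W]. *)
Definition seq_act q W (k : int) : 'cV[F]_m :=
  \sum_(i < size q) q`_i *: W (k + (i : nat)%:Z).

Lemma seq_act_wide q W k N : (size q <= N)%N ->
  seq_act q W k = \sum_(i < N) q`_i *: W (k + (i : nat)%:Z).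
Proof.
move=> le; rewrite /seq_act (big_ord_widen N (fun i => q`_i *: W (k + i%:Z))) //.
rewrite big_mkcond; apply: eq_bigr => i _; case: ltnP => // /(nth_default 0) ->.
by rewrite scale0r.
Qed.

Lemma seq_act0 W k : seq_act 0 W k = 0.
Proof. by rewrite /seq_act size_poly0 big_ord0. Qed.

Lemma seq_actD p q W k : seq_act (p + q) W k = seq_act p W k + seq_act q W k.
Proof.
pose N := maxn (size p) (size q).
rewrite !(@seq_act_wide _ _ _ N) ?leq_maxl ?leq_maxr ?size_polyD //.
by rewrite -big_split; apply: eq_bigr => i _; rewrite coefD scalerDl.
Qed.

Lemma seq_actZ a q W k : seq_act (a *: q) W k = a *: seq_act q W k.
Proof.
rewrite (@seq_act_wide _ _ _ (size q)) ?size_scale_leq // scaler_sumr.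
by apply: eq_bigr => i _; rewrite coefZ scalerA.
Qed.

Lemma seq_actMX q W k : seq_act (q * 'X) W k = seq_act q W (k + 1).
Proof.
rewrite (@seq_act_wide _ _ _ (size q).+1); last first.
  by rewrite (leq_trans (size_polyMleq _ _)) // size_polyX addn2.
rewrite big_ord_recl coefMX scale0r add0r; apply: eq_bigr => i _.
by rewrite coefMX /= -addrA -intS.
Qed.

Lemma seq_actM_eq0 p q W : (forall k, seq_act q W k = 0) ->
  forall k, seq_act (p * q) W k = 0.
Proof.
move=> q0; elim/poly_ind: p => [|p c IH] k; first by rewrite mul0r seq_act0.
rewrite mulrDl seq_actD mulrAC seq_actMX IH mul_polyC seq_actZ q0.
by rewrite scaler0 addr0.
Qed.

Lemma satisfiesE W q :
  satisfies W q <-> q \is monic /\ forall k, seq_act q W k = 0.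
Proof.
suff E : q \is monic -> forall k, seq_act q W k =
    W (k + ((size q).-1)%:Z) -
    \sum_(i < (size q).-1) (- q`_i) *: W (k + (i : nat)%:Z).
  split=> -[qm qW]; split=> // k; first by rewrite E // qW subrr.
  by apply/eqP; rewrite -subr_eq0 -E // qW.
move=> qm k; have sq : size q = (size q).-1.+1.
  by rewrite prednK // size_poly_gt0 monic_neq0.
rewrite (@seq_act_wide _ _ _ (size q).-1.+1); last by rewrite -sq.
rewrite big_ord_recr /= addrC.
congr (_ + _); first by rewrite -lead_coefE (monicP qm) scale1r.
by rewrite -sumrN; apply: eq_bigr => i _; rewrite scaleNr opprK.
Qed.

(** A priori [q] is only a combination of satisfied relations; annihilators are closed under sums
    and multiples. *)
Lemma minimal_polynomial_satisfied W q :
  is_minimal_polynomial W q -> satisfies W q.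
Proof.
move=> [qm qgen]; apply/satisfiesE; split=> // k.
have [u uW ->] := (qgen q).2 (dvdpp q).
rewrite big_seq; elim/big_rec: _ => [|x y xu y0]; first exact: seq_act0.
rewrite seq_actD y0 addr0; apply: seq_actM_eq0.
by have /satisfiesE[] := uW x xu.
Qed.

Lemma linear_complexity_minimal W q n :
  is_minimal_polynomial W q -> is_linear_complexity W n -> n = (size q).-1.
Proof.
move=> [_ qgen] [q' [_ qgen'] ->]; congr _.-1; apply: eqp_size.
rewrite /eqp; apply/andP; split.
  by apply/qgen'/qgen.
by apply/qgen/qgen'.
Qed.

Lemma is_minimal_polynomial_satisfies m' (V : int -> 'cV[F]_m') W q :
  (forall f, satisfies V f <-> satisfies W f) ->
  is_minimal_polynomial W q -> is_minimal_polynomial V q.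
Proof.
move=> VW [qm qgen]; split=> // f; rewrite -qgen.
by split=> -[u uS ->]; exists u => // x /uS /VW.
Qed.

Lemma is_minimal_polynomialP W q :
  satisfies W q -> (forall f, satisfies W f -> q %| f) ->
  is_minimal_polynomial W q.
Proof.
move=> Wq qdvd; have [qm _] := Wq; split=> // f; split=> [[u uW ->]|/dvdpP[a ->]].
  by rewrite big_seq; apply: (big_ind (fun g => q %| g)) => //= [g h|x /uW /qdvd];
    [exact: dvdp_add | exact: dvdp_mull].
by exists [:: (a, q)]; [move=> x; rewrite inE => /eqP -> | rewrite big_seq1].
Qed.

End Relations.

Section Extension.
Variables (F : fieldType) (m : nat) (R : {ffun 'I_m -> nat}).
Implicit Types (W : int -> 'cV[F]_m) (q : {poly F}).

Lemma extensionE W k :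
  extension R W k = \mxcol_i \col_(j < R i) W (k + (j : nat)%:Z) i 0.
Proof.
have iterE S j k' : iter j (@shift F) S k' = S (k' + j%:Z).
  elim: j k' => [|j IH] k' /=; first by rewrite addr0.
  by rewrite /shift IH -addrA intS.
by apply: eq_mxcol => i; apply/colP => j; rewrite !mxE iterE.
Qed.

Lemma seq_act_extension q W k :
  seq_act q (extension R W) k =
    \mxcol_i \col_(j < R i) seq_act q W (k + (j : nat)%:Z) i 0.
Proof.
apply/matrixP => s t; rewrite !mxE !summxE; apply: eq_bigr => i _.
by rewrite extensionE !mxE addrAC.
Qed.

Lemma satisfies_extension W q : (forall i, 0 < R i)%N ->
  satisfies (extension R W) q <-> satisfies W q.
Proof.
move=> R_gt0; rewrite !satisfiesE; split=> -[qm q0]; split=> // k.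
  apply/colP => i; have := q0 k; rewrite seq_act_extension -mxcol0.
  (* Entry 0 of block [i], present because [R i] is positive, is the unshifted component of [W]. *)
  by move/eq_mxcolP/(_ i)/colP/(_ (Ordinal (R_gt0 i))); rewrite !mxE addr0.
rewrite seq_act_extension -mxcol0; apply: eq_mxcol => i.
by apply/colP => j; rewrite mxE q0 !mxE.
Qed.

End Extension.

(** * Matrix states and the dimension of the extension *)

Section States.
Variables (F : finFieldType) (m w : nat) (p : {poly F}).
Hypotheses (p_monic : p \is monic) (sz_p : size p = w.+2).
Let A := companion w.+1 p.
Implicit Type W : int -> 'cV[F]_m.

Lemma mul_companion_last (x : 'rV[F]_w.+1) :
  (x *m A) 0 (inord w) = \sum_(i < w.+1) - p`_i * x 0 i.
Proof.
by rewrite mxE; apply: eq_bigr => i _; rewrite mxE inordK // eqxx mulrC.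
Qed.

Lemma matrix_state_next W k : satisfies W p ->
  matrix_state W w.+1 k *m A = matrix_state W w.+1 (k + 1).
Proof.
move=> [_ Wp]; apply/row_matrixP => i; rewrite row_mul; apply/rowP => b.
rewrite -[b]inord_val; have [bw|wb] := ltnP b w.
  rewrite mul_companion // !mxE !inordK // ?ltnS 1?ltnW //.
  by rewrite -addrA intS.
have -> : (b : nat) = w by apply/eqP; rewrite eqn_leq wb -ltnS ltn_ord.
rewrite mul_companion_last !mxE inordK // -addrA -intS.
have := Wp k; rewrite sz_p /= => ->; rewrite summxE.
by apply: eq_bigr => j _; rewrite !mxE.
Qed.

Lemma matrix_stateX W k (a : nat) : satisfies W p ->
  matrix_state W w.+1 k *m A ^+ a = matrix_state W w.+1 (k + a%:Z).
Proof.
move=> Wp; elim: a => [|a IH]; first by rewrite expr0 mulmx1 addr0.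
by rewrite exprSr mulmxA IH matrix_state_next // -addrA [_ + 1]addrC -intS.
Qed.

Variable R : {ffun 'I_m -> nat}.

(** Since [A] advances a state by one time unit, the rows of the state of the extension are the
    images of row [i] under [A ^+ a] for [a < R i]. The required rank is their number. *)
Lemma dimension_indep W k : satisfies W p ->
  \rank (matrix_state (extension R W) w.+1 k) = (\sum_(i < m) R i)%N <->
  indep R A (matrix_state W w.+1 k).
Proof.
move=> Wp; set X := matrix_state (extension R W) w.+1 k.
have XE : X = \mxcol_i \matrix_(a < R i, b < w.+1) W (k + (a : nat)%:Z + (b : nat)%:Z) i 0.
  by apply/matrixP => s b; rewrite mxE extensionE !mxE addrAC.
have mulX (u : 'I_m -> {poly F}) : (forall i, size (u i) <= R i)%N ->
    (\mxrow_i \row_(a < R i) (u i)`_a) *m X =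
    \sum_(i < m) row i (matrix_state W w.+1 k) *m horner_mx A (u i).
  move=> su; rewrite XE mul_mxrow_mxcol; apply: eq_bigr => i _.
  rewrite (mul_horner_wide _ _ (su i)) mulmx_sum_row; apply: eq_bigr => a _.
  rewrite mxE -row_mul matrix_stateX //; congr (_ *: _).
  by apply/rowP => b; rewrite !mxE.
transitivity (row_free X); first by split=> /eqP.
split=> [fX u su|iX].
  rewrite -mulX // -(mul0mx _ X) => /(row_free_inj fX) e0 i.
  apply/polyP => a; rewrite coef0; have [aR|Ra] := ltnP a (R i); last first.
    by rewrite nth_default // (leq_trans (su i)).
  move: e0; rewrite -mxrow0 => /eq_mxrowP/(_ i)/rowP/(_ (Ordinal aR)).
  by rewrite !mxE.
rewrite -kermx_eq0; apply/rowV0P => v /sub_kermxP vX.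
pose u i := rVpoly (submxrow v i).
have su i : (size (u i) <= R i)%N by apply: size_poly.
have Ev : v = \mxrow_i \row_(a < R i) (u i)`_a.
  rewrite -[LHS]submxrowK; apply: eq_mxrow => i; apply/rowP => a.
  by rewrite [RHS]mxE /u coef_rVpoly_ord.
have u0 : forall i, u i = 0 by apply: iX => //; rewrite -mulX // -Ev.
rewrite Ev -mxrow0; apply: eq_mxrow => i; apply/rowP => a.
by rewrite u0 !mxE coef0.
Qed.

End States.

(** * A multisequence with a prescribed state *)

Section Construction.
Variables (F : finFieldType) (m w : nat) (p : {poly F}).
Hypotheses (p_monic : p \is monic) (sz_p : size p = w.+2)
  (p_irr : irreducible_poly p).
Let A := companion w.+1 p.

(** Having degree at least 2, [p] cannot divide ['X], which acts as [A]. *)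
Lemma companion_unit : (0 < w)%N -> A \is a GRing.unit.
Proof.
move=> w_gt0; have /horner_companion_unit : ~~ (p %| 'X).
  apply: contraTN w_gt0 => /(dvdp_leq (negbT (polyX_eq0 F))).
  by rewrite sz_p size_polyX; case: w.
by move=> /(_ _ p_monic sz_p p_irr); rewrite horner_mx_X.
Qed.

Lemma unit_mx_finite_order (B : 'M[F]_w.+1) : B \is a GRing.unit ->
  exists2 T : nat, (0 < T)%N & B ^+ T = 1.
Proof.
move=> uB; pose b := FinRing.unit _ uB; exists #[b]%g; first exact: order_gt0.
have := congr1 val (expg_order b).
by rewrite FinRing.val_unitX.
Qed.

Variable M : 'M[F]_(m, w.+1).

(** As [A] shifts rows to the left, the first column suffices to read off the sequence. Integer
    exponents give the negative times once [A] is invertible. *)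
Definition multiseq_of_state (k : int) : 'cV[F]_m := col 0 (M *m A ^ k).
Let W := multiseq_of_state.

Hypothesis A_unit : A \is a GRing.unit.

Lemma multiseq_of_state_periodic : periodic W.
Proof.
have [T T_gt0 AT] := unit_mx_finite_order A_unit; exists T => // k.
by rewrite /W /multiseq_of_state exprzDr // -exprnP AT mulr1.
Qed.

Lemma multiseq_stateX k (a : nat) (i : 'I_m) : (a <= w)%N ->
  W (k + a%:Z) i 0 = (M *m A ^ k) i (inord a).
Proof.
move=> aw; rewrite mxE exprzDr // -exprnP mulmxA.
have := mul_companionX p (row i (M *m A ^ k)) (a := a) (b := 0).
rewrite addn0 -row_mul => /(_ aw); rewrite !mxE (_ : inord 0 = 0) //.
by apply/val_inj; rewrite /= inordK.
Qed.

Lemma matrix_state_multiseq k : matrix_state W w.+1 k = M *m A ^ k.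
Proof.
apply/matrixP => i b; rewrite mxE multiseq_stateX ?inord_val //.
by rewrite -ltnS ltn_ord.
Qed.

Lemma seq_act_multiseq q k : seq_act q W k = col 0 (M *m A ^ k *m horner_mx A q).
Proof.
rewrite -[in RHS](coefK q) poly_def rmorph_sum mulmx_sumr linear_sum.
apply: eq_bigr => i _ /=; rewrite horner_mxZ rmorphXn /= horner_mx_X.
rewrite -scalemxAr linearZ /= /W /multiseq_of_state exprzDr // -exprnP.
by rewrite -mulmxA.
Qed.

(** Any relation [q] of [W] kills the nonzero row [c], which forces [p %| q] because [p] is
    irreducible. *)
Lemma multiseq_minimal_polynomial (c : 'I_m) : row c M != 0 ->
  is_minimal_polynomial W p.
Proof.
move=> Mc; apply: is_minimal_polynomialP.
  apply/satisfiesE; split=> // k.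
  by rewrite seq_act_multiseq horner_companion // mulmx0 linear0.
move=> q /satisfiesE[_ q0].
apply: (horner_companion_ker p_monic sz_p p_irr Mc).
(* Entry [b] is the first entry after [b] more shifts, hence component [c] of [seq_act q W] at time
   [b]. *)
apply/rowP => b; have := mul_companionX p (row c M *m horner_mx A q) (a := b) (b := 0).
rewrite addn0 inord_val -ltnS => /(_ (ltn_ord b)) <-; rewrite [RHS]mxE.
have /colP/(_ c) := q0 b; rewrite seq_act_multiseq [RHS]mxE => <-.
rewrite -exprnP -!mulmxA -row_mul !mxE (_ : inord 0 = 0); last first.
  by apply/val_inj; rewrite /= inordK.
have -> : horner_mx A q *m A ^+ b = A ^+ b *m horner_mx A q.
  by apply: comm_horner_mx; apply: (commrX b (commr_refl A)).
by apply: eq_bigr.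
Qed.

(** Each state is [M] times an invertible matrix commuting with [A], so independence at time 0 holds
    at all times. *)
Lemma multiseq_dimension (R : {ffun 'I_m -> nat}) :
  (forall i, 0 < R i)%N -> (exists c, row c M != 0) -> indep R A M ->
  has_dimension (extension R W) (\sum_(i < m) R i)%N.
Proof.
move=> R_gt0 [c Mc] iM; have Wp := multiseq_minimal_polynomial Mc.
exists w.+1.
  exists p; last by rewrite sz_p.
  by apply: is_minimal_polynomial_satisfies Wp => f; apply: satisfies_extension.
move=> k; apply/(dimension_indep sz_p).
  exact: minimal_polynomial_satisfied.
rewrite matrix_state_multiseq; apply: indep_mulr => //.
  exact: unitrXz.
exact/commrXz.
Qed.

End Construction.

(** * The matrix-extension algorithm *)

Section Enlarge.
Variables (F : finFieldType) (m : nat) (c : 'I_m).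

Lemma row_enlarge j (d : 'I_m -> F) (N : 'M[F]_(m, j)) :
  row c (enlarge c d N) = last_unit F j.+1.
Proof. by apply/rowP => k; rewrite !mxE eqxx. Qed.

Lemma enlarge_low w (d : 'I_m -> F) (N : 'M[F]_(m, w.+1)) i k :
  i != c -> (k <= w)%N -> enlarge c d N i (inord k) = N i (inord k).
Proof.
move=> /negbTE ic kw; rewrite mxE ic.
have -> : inord k = lift ord_max (inord k : 'I_w.+1) :> 'I_w.+2.
  by apply: ord_inj; rewrite lift_max !inordK // ltnS ltnW.
by rewrite liftK.
Qed.

(* A right inverse of enlarge: enlarge forgets row c, which is the last unit
   vector at that stage of the algorithm. *)
Definition shrink w (M : 'M[F]_(m, w.+2)) : 'M[F]_(m, w.+1) :=
  \matrix_(i < m, k < w.+1)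
    if i == c then last_unit F w.+1 0 k else M i (widen_ord (leqnSn _) k).

Lemma row_shrink w (M : 'M[F]_(m, w.+2)) :
  row c (shrink M) = last_unit F w.+1.
Proof. by apply/rowP => k; rewrite !mxE eqxx. Qed.

Lemma shrink_low w (M : 'M[F]_(m, w.+2)) i k :
  i != c -> (k <= w)%N -> M i (inord k) = shrink M i (inord k).
Proof.
move=> /negbTE ic kw; rewrite mxE ic; congr (M i _).
by apply: val_inj; rewrite /= !inordK // ltnS ltnW.
Qed.

Lemma shrinkK w (M : 'M[F]_(m, w.+2)) : row c M = last_unit F w.+2 ->
  enlarge c (fun i => M i ord_max) (shrink M) = M.
Proof.
move=> Mc; apply/matrixP => i k; rewrite mxE.
case: eqP => [->|/eqP ic]; first by rewrite -Mc mxE.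
case: unliftP => [k' ->|-> //]; rewrite mxE (negbTE ic); congr (M i _).
by apply: ord_inj; rewrite lift_max.
Qed.

End Enlarge.

Section Algorithm.
Variables (F : finFieldType) (m n r : nat) (R : {ffun 'I_m -> nat}).
Hypotheses (R_gt0 : forall i : 'I_m, (0 < R i)%N)
  (sumR : (\sum_(i < m) R i)%N = r) (m_gt0 : (0 < m)%N)
  (lt_m_r : (m < r)%N) (le_r_n : (r <= n)%N).
Variable p : nat -> {poly F}.
Hypothesis p_irr : forall j : nat, (n - r + m <= j <= n)%N ->
  [/\ p j \is monic, size (p j) = j.+1 & irreducible_poly (p j)].

(* The point of the R-road of coordinate sum g. *)
Let road g := iter (r - g) (@Phi m) R.

(** The match exposes a successor width, as [horner_mx] requires. *)
Let indep_at (G : 'I_m -> nat) (j : nat) : 'M[F]_(m, j) -> Prop :=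
  if j is w.+1 then fun M => indep G (companion w.+1 (p w.+1)) M
  else fun=> True.

Lemma roadP g : (m <= g <= r)%N ->
  [/\ on_road R (road g), forall i, (0 < road g i)%N
    & (\sum_(i < m) road g i = g)%N].
Proof.
move=> /andP[mg gr]; have [|rG G_gt0 sG] := iter_Phi_road (t := r - g) R_gt0 m_gt0.
  by rewrite sumR; lia.
split=> //; rewrite -/(road g) sumR in sG; lia.
Qed.

Lemma road_start : road m = [ffun=> 1%N].
Proof.
have [|_ G_gt0 sG] := @roadP m; first by rewrite leqnn ltnW.
exact: sum_eq1.
Qed.

Lemma road_Phi g : (g < r)%N -> road g = Phi (road g.+1).
Proof. by move=> gr; rewrite /road -(subnSK gr). Qed.

(** The algorithm raises the coordinate that [Phi] lowered, so it climbs the road back to [R]. The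
    two bounds feed [indep_raise]. *)
Lemma road_active g : (m <= g < r)%N -> exists c,
  [/\ first_max (road g.+1) c, active R (road g) c,
      [ffun i => if i == c then (road g i).+1 else road g i] = road g.+1,
      (road g c <= g)%N &
      forall i, (road g i <= (road g c).+1)%N].
Proof.
move=> /andP[mg gr]; have [|rG G_gt0 sG] := @roadP g.+1; first by lia.
have [c Hc] := first_max_ex (road g.+1) m_gt0; exists c.
have G1 : (1 < gmax (road g.+1))%N by apply: gmax_gt1; rewrite sG.
have [_ act] := on_road_Phi rG G1 Hc.
have [|_ _ sG'] := @roadP g; first by lia.
rewrite road_Phi // in sG' *; split=> //; first exact: raise_Phi.
  by rewrite -[X in (_ <= X)%N]sG' (bigD1 c) //= leq_addr.
move=> i; rewrite (Phi_first_max Hc) !ffunE eqxx prednK //.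
have /andP[/eqP -> _] := Hc; apply: leq_trans (leq_gmax _ i).
by case: eqP => // _; exact: leq_pred.
Qed.

(** The loop invariant. Its last clause names the coordinate raised by the latest step, hence the
    guard [m < g]: the initial matrix has no prescribed row. *)
Lemma alg_state_inv G g j (M : 'M[F]_(m, j)) :
  alg_state n r R p G g M ->
  [/\ (m <= g <= r)%N, j = (n - r + g)%N, G = road g, indep_at G M &
      (m < g)%N -> exists c,
        active R (Phi (road g)) c /\ row c M = last_unit F j].
Proof.
elim=> {G g j M} [M fM|G g j M c f d _ [mgr Ej EG iM _] gr act Mf].
  split=> //; rewrite ?leqnn ?road_start ?ltnn //; first exact: ltnW.
  case: (n - r + m)%N M fM => //= w M /(indep1 (companion w.+1 (p w.+1))) iM.
  by move=> u su; apply: iM => i; have := su i; rewrite ffunE.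
have [|c' [Hc act' raise Gcg Gle]] := @road_active g; first by lia.
subst G; have Ec := active_uniq act' act; subst c'.
rewrite raise; split=> //; [by lia | by lia | | move=> _].
  have [|pm sp pirr] := p_irr (j := j.+1); first by lia.
  have f_unit : horner_mx (companion j.+1 (p j.+1)) f \in unitmx.
    apply: horner_companion_unit => //.
    by apply: (horner_companion_kerN pm sp (x := row c M)); rewrite Mf last_unit_neq0.
  apply: (indep_raise (p j.+1) (p j.+2) (c := c) (G := road g)
    (N := M *m horner_mx (companion j.+1 (p j.+1)) f) _ _ _ _ _ _ _).1.
  - by rewrite row_mul Mf.
  - exact: row_enlarge.
  - by move=> i k ic kw; apply: enlarge_low.
  - by rewrite -raise ffunE eqxx.
  - by move=> i /negbTE ic; rewrite -raise ffunE ic.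
  - by apply: leq_trans Gcg _; lia.
  - by move=> i _.
  - apply: indep_mulr => //.
    by apply: comm_mx_horner.
exists c; rewrite -road_Phi //; split=> //; exact: row_enlarge.
Qed.

(** The backward run, by induction on [g]: [shrink] undoes the enlargement, and an inverse modulo
    the polynomial undoes the multiplication. *)
Lemma alg_state_road g j (M : 'M[F]_(m, j)) : (m < g <= r)%N ->
  j = (n - r + g)%N -> indep_at (road g) M ->
  (exists2 c, first_max (road g) c & row c M = last_unit F j) ->
  alg_state n r R p (road g) g M.
Proof.
elim: g j M => [|g IH] j M; first by [].
move=> /andP[mg gr] Ej iM [c Hc Mc].
have [|c' [Hc' act raise Gcg Gle]] := @road_active g; first by lia.
have Ec := first_max_uniq Hc' Hc; subst c'.
case: j M Ej iM Mc => [|[|w]] M Ej iM Mc; [by exfalso; lia | by exfalso; lia |].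
pose N := shrink c M; pose A := companion w.+1 (p w.+1).
have iN : indep (road g) A N.
  apply: (indep_raise (p w.+1) (p w.+2) (c := c) (G := road g) _ _ _ _ _ _ _).2 iM => //.
  - exact: row_shrink.
  - by move=> i k ic kw; apply: shrink_low.
  - by rewrite -raise ffunE eqxx.
  - by move=> i /negbTE ic; rewrite -raise ffunE ic.
  - by apply: leq_trans Gcg _; lia.
suff [M' [f [sM' Ef]]] : exists (M' : 'M[F]_(m, w.+1)) f,
    alg_state n r R p (road g) g M' /\ M' *m horner_mx A f = N.
  rewrite -raise -(shrinkK Mc) -/N -Ef; apply: AlgStep => //.
  by rewrite -row_mul -/A Ef row_shrink.
(* At the bottom of the road [N] is itself a legal initial matrix, with multiplier 1. *)
have [Eg|ne] := eqVneq g m.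
  exists N, 1; split; last by rewrite rmorph1 mulmx1.
  rewrite Eg road_start; have Ew : w.+1 = (n - r + m)%N by lia.
  have fN : row_free N.
    apply/(indep1 A) => u su; apply: iN => i; rewrite Eg road_start ffunE; exact: su.
  move: N fN {iN}; rewrite Ew => N; exact: AlgInit.
(* Higher up, the preceding step must have left the last unit vector in row [c'], the first maximum
   of [road g]. Here [h] brings that row of [N] into this form, and its inverse [f] leads back to
   [N]. *)
have [|c' [Hc'' _ _ _ _]] := @road_active g.-1; first by lia.
rewrite prednK in Hc''; last by lia.
have [|pm sp pirr] := p_irr (j := w.+1); first by lia.
have Nc' : row c' N != 0.
  apply: indep_row_neq0 iN _; have [|_ G_gt0 _] := @roadP g; [lia | exact: G_gt0].
have [h Nh] := horner_to_last_unit pm sp pirr Nc'.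
have h_ndvd : ~~ (p w.+1 %| h).
  by apply: (horner_companion_kerN pm sp (x := row c' N)); rewrite Nh last_unit_neq0.
have [f hf] := horner_companion_inv pm sp pirr h_ndvd.
exists (N *m horner_mx A h), f; split; last by rewrite -mulmxA hf mulmx1.
apply: IH; [by lia | by lia | | by exists c' => //; rewrite row_mul].
apply: indep_mulr => //; first exact: horner_companion_unit.
exact: comm_mx_horner.
Qed.

End Algorithm.

Theorem mainTheorem4 (F : finFieldType) (m n r : nat)
  (R : {ffun 'I_m -> nat})
  (R_gt0 : forall i : 'I_m, (0 < R i)%N)
  (sumR : (\sum_(i < m) R i)%N = r)
  (lt_m_r : (m < r)%N) (le_r_n : (r <= n)%N)
  (p : nat -> {poly F})
  (p_prim : forall j : nat, (n - r + m <= j <= n)%N ->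
              primitive_polynomial j (p j))
  (c2 : 'I_m) (c2_active : active R (Phi R) c2)
  (M : 'M[F]_(m, n)) :
  alg_output r R p M <->
  row c2 M = last_unit F n /\
  exists W : int -> 'cV[F]_m,
    [/\ periodic W,
        is_minimal_polynomial W (p n),
        is_matrix_state_of W M
      & has_dimension (extension R W) r].
Proof.
have p_irr j le_j := primitive_irreducible (p_prim j le_j).
have m_gt0 : (0 < m)%N by apply: leq_ltn_trans (ltn_ord c2).
have [|pm sp pirr] := p_irr n; first by lia.
case: n p_prim p_irr M le_r_n pm sp pirr => [|w] p_prim p_irr M le_r_n pm sp pirr.
  by exfalso; lia.
have roadr : iter (r - r) (@Phi m) R = R by rewrite subnn.
split=> [[G [g [sM]]]|[Mc2 [W [_ Wmin [_ [k EM]] Wdim]]]].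
  have [/andP[_ gr] _ EG iM last] := alg_state_inv R_gt0 sumR m_gt0 lt_m_r le_r_n p_irr sM.
  rewrite -leqNgt => rg; have Eg : g = r by apply/eqP; rewrite eqn_leq gr.
  subst g G; rewrite roadr /= in iM.
  have [c [act Mc]] := last lt_m_r; rewrite roadr in act.
  have Ec := active_uniq act c2_active; subst c; split=> //.
  have Mc_neq0 : row c2 M != 0 by rewrite Mc last_unit_neq0.
  have w_gt0 : (0 < w)%N by lia.
  have uA := companion_unit pm sp pirr w_gt0.
  have Wmin := multiseq_minimal_polynomial pm sp pirr uA Mc_neq0.
  exists (multiseq_of_state (p w.+1) M); split=> //.
  - exact: multiseq_of_state_periodic.
  - split; first by exists (p w.+1) => //; rewrite sp.
    by exists 0; rewrite matrix_state_multiseq // mulmx1.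
  - by rewrite -sumR; apply: multiseq_dimension => //; exists c2.
have Wp := minimal_polynomial_satisfied Wmin.
(* [Wdim] speaks of states of an unnamed width; the minimal polynomial of the extension fixes that
   width to [w.+1]. *)
have eWmin : is_minimal_polynomial (extension R W) (p w.+1).
  by apply: is_minimal_polynomial_satisfies Wmin => f; apply: satisfies_extension.
have [n' lc rk] := Wdim.
have En' := linear_complexity_minimal eWmin lc; rewrite sp /= in En'; subst n'.
have iM : indep R (companion w.+1 (p w.+1)) M.
  by rewrite EM; apply/(dimension_indep sp) => //; rewrite rk sumR.
exists R, r; rewrite ltnn; split=> //; rewrite -{2}roadr.
apply: alg_state_road => //; [by rewrite lt_m_r leqnn | by lia | by rewrite roadr |].
(* The first maximum of [R] is the active coordinate of [Phi R], that is, [c2]. *)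
rewrite roadr; have [c Hc] := first_max_ex R m_gt0; exists c => //.
have R1 : (1 < gmax R)%N by apply: gmax_gt1; rewrite sumR.
have [_ act] := on_road_Phi (on_road_start R_gt0 m_gt0) R1 Hc.
by rewrite (active_uniq act c2_active).
Qed.
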